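(* Let $(R,\tau)$ be a rigid topological ring. Then $(\mathbf{TopFreeMod}_{(R,\tau)},\circledast_{(R,\tau)},(R,\tau))$, with the canonical associativity, unit and symmetry constraints, is a symmetric monoidal category.
   Context: Rings are commutative and unital; all topologies are Hausdorff. A topological ring $(R,\tau)$ is a ring with a topology making addition, negation and multiplication (jointly) continuous. Topological $(R,\tau)$-modules (continuous addition, negation and scalar multiplication) with continuous $R$-linear maps form $\mathbf{TopMod}_{(R,\tau)}$. For a set $X$, $(R,\tau)^X$ is $R^X$ with the product topology, $R^{(X)}$ is the module of finitely supported maps. $(M,\sigma)'$ is the $R$-module of continuous linear maps $(M,\sigma)\to (R,\tau)$, and $f'(\ell)=\ell\circ f$. $(R,\tau)$ is rigid if for every set $X$ the map $\lambda_X\colon R^{(X)}\to((R,\tau)^X)'$, $\lambda_X(p)(f)=\sum_x p(x)f(x)$, is an isomorphism. For an $R$-module $M$, $M^*=\mathrm{Hom}_R(M,R)$ carries the weak-$*$ topology $w^*_{(R,\tau)}$ (initial topology for the evaluations $\ell\mapsto\ell(v)\in (R,\tau)$, $v\in M$), and $f^*(\ell)=\ell\circ f$. $\mathbf{TopFreeMod}_{(R,\tau)}$ is the full subcategory of $\mathbf{TopMod}_{(R,\tau)}$ of objects isomorphic to some $(R,\tau)^X$ (topologically-free modules). Topological tensor product (for rigid $(R,\tau)$): on objects, $(M,\sigma)\circledast_{(R,\tau)}(N,\gamma):=\big(((M,\sigma)'\otimes_R(N,\gamma)')^*,w^*_{(R,\tau)}\big)$, which is again topologically-free; on morphisms, $f_1\circledast_{(R,\tau)}f_2:=(f_1'\otimes_R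 f_2')^*$. For $u\in M$, $v\in N$, $u\circledast v\in (M,\sigma)\circledast_{(R,\tau)}(N,\gamma)$ is given by $(u\circledast v)(\ell_1\otimes\ell_2)=\ell_1(u)\ell_2(v)$. The constraints are the isomorphisms of topologically-free modules determined by $(u\circledast v)\circledast w\mapsto u\circledast(v\circledast w)$, $1_R\circledast v\mapsto v$, $u\circledast 1_R\mapsto u$, $u\circledast v\mapsto v\circledast u$ (it suffices to prescribe continuous linear maps on the elements $u\circledast v$ because these span a dense submodule). *)

(* Defs.v *)
From HB Require Import structures.
From mathcomp Require Import all_boot all_algebra finmap.
From mathcomp Require Import generic_quotient ring_quotient.
From mathcomp Require Import all_classical.
From mathcomp Require Import topology_structure initial_topology.
From mathcomp Require Import supremum_topology product_topology.
From mathcomp Require Import separation_axioms function_spaces.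
From mathcomp Require Import pseudometric_normed_Zmodule.

Set Implicit Arguments.
Unset Strict Implicit.
Unset Printing Implicit Defensive.

Import GRing.Theory.
Local Open Scope classical_set_scope.
Local Open Scope ring_scope.

(******************************************************************************)
(* For R : topRingType (a Hausdorff commutative topological ring):            *)
(*          rpow R X == (R, tau)^X                                            *)
(*         fsmap R X == R^(X); fsunit x is its canonical basis                *)
(*            dual N == N^* with its weak-star topology; dual_map f == f^*    *)
(*         topdual M == M', as a plain module; topdual_map f == f'            *)
(*        tensor M N == the tensor product of plain modules over R            *)
(*          pure m n == the elementary tensor of m : M and n : N              *)
(*     toptensor M N == (M' (x) N')^*; toptensor_map for morphisms            *)
(*       toppure u v == the element of toptensor M N defined by u and v       *)
(******************************************************************************)

Record category := Category {
  obj :> Type;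
  hom : obj -> obj -> Type;
  idm : forall A, hom A A;
  mcomp : forall A B C, hom B C -> hom A B -> hom A C;
  compmA : forall A B C D (h : hom C D) (g : hom B C) (f : hom A B),
    mcomp h (mcomp g f) = mcomp (mcomp h g) f;
  comp1m : forall A B (f : hom A B), mcomp (idm B) f = f;
  compm1 : forall A B (f : hom A B), mcomp f (idm A) = f
}.
Arguments hom {c} A B.
Arguments idm {c} A.
Arguments mcomp {c A B C} g f.

Declare Scope cat_scope.
Delimit Scope cat_scope with cat.
Notation "g '\oc' f" := (mcomp g f)
  (at level 50, left associativity) : cat_scope.
Local Open Scope cat_scope.

Definition is_iso (C : category) (A B : C) (f : hom A B) : Prop :=
  exists g : hom B A, g \oc f = idm A /\ f \oc g = idm B.

Definition isomorphic (C : category) (A B : C) : Prop :=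
  exists f : hom A B, is_iso f.

Definition full_subcategory (C : category) (P : C -> Prop) : category :=
  @Category {A : C | P A} (fun A B => hom (sval A) (sval B))
    (fun A => idm (sval A)) (fun A B D g f => g \oc f)
    (fun A B D E h g f => compmA h g f)
    (fun A B f => comp1m f) (fun A B f => compm1 f).

Record tensor_data (C : category) := TensorData {
  tens : C -> C -> C;
  tensm : forall A A' B B' : C,
    hom A A' -> hom B B' -> hom (tens A B) (tens A' B');
  tunit : C
}.
Arguments tunit {C} t.

Record constraints (C : category) (T : tensor_data C) := Constraints {
  cassoc : forall A B D : C,
    hom (tens T (tens T A B) D) (tens T A (tens T B D));
  clunit : forall A : C, hom (tens T (tunit T) A) A;
  crunit : forall A : C, hom (tens T A (tunit T)) A;
  csym : forall A B : C, hom (tens T A B) (tens T B A)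
}.

(* csym_iso and csym_unit follow from the other axioms. *)
Record symmetric_monoidal (C : category) (T : tensor_data C)
    (k : constraints T) : Prop := SymmetricMonoidal {
  tensm_id : forall A B : C, tensm T (idm A) (idm B) = idm (tens T A B);
  tensm_comp : forall (A A' A'' B B' B'' : C)
      (f' : hom A' A'') (f : hom A A') (g' : hom B' B'') (g : hom B B'),
    tensm T (f' \oc f) (g' \oc g) = tensm T f' g' \oc tensm T f g;
  cassoc_iso : forall A B D, is_iso (cassoc k A B D);
  clunit_iso : forall A, is_iso (clunit k A);
  crunit_iso : forall A, is_iso (crunit k A);
  csym_iso : forall A B, is_iso (csym k A B);
  cassoc_natural : forall (A A' B B' D D' : C)
      (f : hom A A') (g : hom B B') (h : hom D D'),
    cassoc k A' B' D' \oc tensm T (tensm T f g) h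
    = tensm T f (tensm T g h) \oc cassoc k A B D;
  clunit_natural : forall (A A' : C) (f : hom A A'),
    clunit k A' \oc tensm T (idm (tunit T)) f = f \oc clunit k A;
  crunit_natural : forall (A A' : C) (f : hom A A'),
    crunit k A' \oc tensm T f (idm (tunit T)) = f \oc crunit k A;
  csym_natural : forall (A A' B B' : C) (f : hom A A') (g : hom B B'),
    csym k A' B' \oc tensm T f g = tensm T g f \oc csym k A B;
  pentagon : forall A B D E : C,
    cassoc k A B (tens T D E) \oc cassoc k (tens T A B) D E
    = tensm T (idm A) (cassoc k B D E) \oc cassoc k A (tens T B D) E
        \oc tensm T (cassoc k A B D) (idm E);
  triangle : forall A B : C,
    tensm T (idm A) (clunit k B) \oc cassoc k A (tunit T) B
    = tensm T (crunit k A) (idm B);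
  csymK : forall A B : C, csym k B A \oc csym k A B = idm (tens T A B);
  csym_unit : forall A : C, clunit k A \oc csym k A (tunit T) = crunit k A;
  hexagon : forall A B D : C,
    cassoc k B D A \oc csym k A (tens T B D) \oc cassoc k A B D
    = tensm T (idm B) (csym k A D) \oc cassoc k B A D
        \oc tensm T (csym k A B) (idm D)
}.

(* The library's topologicalLmodType is not usable here: its scalars form a   *)
(* numDomainType.  Scalars below may form the zero ring.                      *)

HB.mixin Record isTopRing R & Topological R & GRing.ComPzRing R := {
  topring_add_continuous : continuous (fun z : R * R => z.1 + z.2);
  topring_opp_continuous : continuous (fun x : R => - x);
  topring_mul_continuous : continuous (fun z : R * R => z.1 * z.2);
  topring_hausdorff : hausdorff_space R
}.

#[short(type="topRingType")]
HB.structure Definition TopRing :=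
  {R of Topological R & GRing.ComPzRing R & isTopRing R}.

#[short(type="preTopModType")]
HB.structure Definition PreTopMod (R : topRingType) :=
  {M of Topological M & GRing.Lmodule R M}.

HB.mixin Record isTopMod (R : topRingType) M & PreTopMod R M := {
  topmod_add_continuous : continuous (fun z : M * M => z.1 + z.2);
  topmod_opp_continuous : continuous (fun x : M => - x);
  topmod_scale_continuous : continuous (fun z : R * M => z.1 *: z.2);
  topmod_hausdorff : hausdorff_space M
}.

#[short(type="topModType")]
HB.structure Definition TopMod (R : topRingType) :=
  {M of PreTopMod R M & isTopMod R M}.

(* A copy of R carrying its module structure over itself. *)
Definition selfmod (R : topRingType) : Type := R.

HB.instance Definition _ (R : topRingType) := Topological.copy (selfmod R) R.
HB.instance Definition _ (R : topRingType) :=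
  GRing.Lmodule.copy (selfmod R) R^o.
HB.instance Definition _ (R : topRingType) :=
  isTopMod.Build R (selfmod R) (@topring_add_continuous R)
    (@topring_opp_continuous R) (@topring_mul_continuous R)
    (@topring_hausdorff R).

Section InitialTopology.
Variables (V : choiceType) (I : Type) (T : I -> topologicalType).
Variable phi : forall i, V -> T i.

(* The library's product topology is the case of the projections. *)
Definition initial_family_topology :=
  sup_topology (fun i => Topological.class (initial_topology (phi i))).

HB.instance Definition _ :=
  Topological.copy initial_family_topology
    (sup_topology (fun i => Topological.class (initial_topology (phi i)))).

Lemma initial_family_continuous i :
  continuous (phi i : initial_family_topology -> T i).
Proof.
move=> v; have /cvg_sup/(_ i) := @cvg_id _ (nbhs (v : initial_family_topology)).
by move=> cv; apply: cvg_trans (initial_continuous (f := phi i) (x := v)); exact: cvg_app.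
Qed.

Lemma continuous_to_initial_family (X : topologicalType)
    (h : X -> initial_family_topology) :
  (forall i, continuous (phi i \o h)) -> continuous h.
Proof.
move=> ch x; apply/cvg_sup => i.
exact: (@continuous_comp_initial _ _ _ (phi i) h (ch i)).
Qed.

End InitialTopology.

Section InitialTopMod.
Variables (R : topRingType) (V : preTopModType R) (I : Type).
Variable phi : I -> {linear V -> selfmod R}.
Hypothesis phi_cont : forall i, continuous (phi i).
Hypothesis phi_init : forall (X : topologicalType) (h : X -> V),
  (forall i, continuous (fun x => phi i (h x))) -> continuous h.
Hypothesis phi_inj : forall u v : V, (forall i, phi i u = phi i v) -> u = v.

Lemma initial_add_continuous : continuous (fun z : V * V => z.1 + z.2).
Proof.
apply: phi_init => i; under eq_fun do rewrite linearD.
move=> z; apply: (@continuous_comp _ _ _ (fun z : V * V => (phi i z.1, phi i z.2))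
   (fun z : selfmod R * selfmod R => z.1 + z.2)); last exact: topmod_add_continuous.
apply: cvg_pair => /=.
- by apply: (@continuous_comp _ _ _ fst); [exact: cvg_fst | exact: phi_cont].
- by apply: (@continuous_comp _ _ _ snd); [exact: cvg_snd | exact: phi_cont].
Qed.

Lemma initial_opp_continuous : continuous (fun v : V => - v).
Proof.
apply: phi_init => i; under eq_fun do rewrite linearN.
move=> z; apply: (@continuous_comp _ _ _ (phi i) (fun a : selfmod R => - a)).
- exact: phi_cont.
- exact: topmod_opp_continuous.
Qed.

Lemma initial_scale_continuous : continuous (fun z : R * V => z.1 *: z.2).
Proof.
apply: phi_init => i; under eq_fun do rewrite linearZ.
move=> z; apply: (@continuous_comp _ _ _ (fun z : R * V => (z.1, phi i z.2))
   (fun z : R * selfmod R => z.1 *: z.2)); last exact: topmod_scale_continuous.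
apply: cvg_pair => /=; first exact: cvg_fst.
by apply: (@continuous_comp _ _ _ snd); [exact: cvg_snd | exact: phi_cont].
Qed.

Lemma initial_hausdorff : hausdorff_space V.
Proof.
move=> u v uv; apply: phi_inj => i; apply: topmod_hausdorff => A B nA nB.
have [w [Aw Bw]] := uv _ _ (phi_cont nA) (phi_cont nB).
by exists (phi i w).
Qed.

End InitialTopMod.

Section TopModTheory.
Variables (R : topRingType) (Y : topologicalType) (V : topModType R).

Lemma continuous_linear_comb (a : R) (f g : Y -> V) :
  continuous f -> continuous g -> continuous (fun y => a *: f y + g y).
Proof.
move=> cf cg x; apply: (@continuous_comp _ _ _ (fun x => (a *: f x, g x))
  (fun z : V * V => z.1 + z.2)); last exact: topmod_add_continuous.
apply: cvg_pair => /=; last exact: cg.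
apply: (@continuous_comp _ _ _ (fun x => (a, f x))
  (fun z : R * V => z.1 *: z.2)); last exact: topmod_scale_continuous.
by apply: cvg_pair => /=; [exact: cvg_cst | exact: cf].
Qed.

Lemma continuous_sum (I : Type) (s : seq I) (c : I -> R) (f : I -> Y -> V) :
  (forall i, continuous (f i)) ->
  continuous (fun y => \sum_(i <- s) c i *: f i y).
Proof.
move=> cf; elim: s => [|i s ih].
  by under eq_fun do rewrite big_nil; move=> y; exact: cvg_cst.
by under eq_fun do rewrite big_cons; exact: continuous_linear_comb.
Qed.

End TopModTheory.

Definition rpow (R : topRingType) (X : Type) : Type := X -> selfmod R.

Section Rpow.
Variables (R : topRingType) (X : Type).

HB.instance Definition _ := GRing.Lmodule.copy (rpow R X) (X -> selfmod R).
HB.instance Definition _ :=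
  Topological.copy (rpow R X) (prod_topology (fun _ : X => selfmod R)).

Definition rpow_proj (x : X) : rpow R X -> selfmod R := fun f => f x.

Fact rpow_proj_linear x : linear (rpow_proj x).
Proof. by []. Qed.

HB.instance Definition _ x :=
  GRing.isLinear.Build R (rpow R X) (selfmod R) _ (rpow_proj x)
    (rpow_proj_linear x).

Lemma rpow_proj_continuous x : continuous (rpow_proj x).
Proof.
exact: (@initial_family_continuous (rpow R X) X (fun=> selfmod R) rpow_proj x).
Qed.

Lemma continuous_to_rpow (Y : topologicalType) (h : Y -> rpow R X) :
  (forall x, continuous (fun y => h y x)) -> continuous h.
Proof.
exact: (@continuous_to_initial_family (rpow R X) X (fun=> selfmod R) rpow_proj).
Qed.

Lemma rpow_proj_inj (f g : rpow R X) :
  (forall x, rpow_proj x f = rpow_proj x g) -> f = g.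
Proof. exact: funext. Qed.

HB.instance Definition _ := isTopMod.Build R (rpow R X)
  (initial_add_continuous rpow_proj_continuous continuous_to_rpow)
  (initial_opp_continuous rpow_proj_continuous continuous_to_rpow)
  (initial_scale_continuous rpow_proj_continuous continuous_to_rpow)
  (initial_hausdorff rpow_proj_continuous rpow_proj_inj).

End Rpow.

Section FinitelySupported.
Variables (R : topRingType) (X : Type).

Definition finitely_supported : {pred X -> selfmod R} :=
  fun p => `[< finite_set [set x | p x <> 0] >].

Fact finitely_supported_closed : submod_closed finitely_supported.
Proof.
split=> [|a p q /asboolP fp /asboolP fq].
  by apply/asboolP; apply: sub_finite_set (finite_set0 _) => x /=.
apply/asboolP; apply: (@sub_finite_set _ _ ([set x | p x <> 0] `|` [set x | q x <> 0])).
  move=> x /= h; apply: contrapT => /not_orP[/contrapT p0 /contrapT q0].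
  by apply: h; rewrite !fctE p0 q0 scaler0 addr0.
by rewrite finite_setU.
Qed.

HB.instance Definition _ := GRing.isSubmodClosed.Build R (X -> selfmod R)
  finitely_supported finitely_supported_closed.

Record fsmap := FsMap {
  fsmap_fun :> X -> selfmod R;
  fsmap_fin : fsmap_fun \in finitely_supported
}.

HB.instance Definition _ := [isSub for fsmap_fun].
HB.instance Definition _ := [Choice of fsmap by <:].
HB.instance Definition _ := [SubChoice_isSubLmodule of fsmap by <:].

Lemma fsmapP (p q : fsmap) : p =1 q -> p = q.
Proof. by move=> pq; apply: val_inj; apply: funext. Qed.

End FinitelySupported.

Section FsMapTheory.
Variables (R : topRingType) (X : choiceType).

Fact fsunit_fin (x : X) :
  (fun y => if `[< y = x >] then 1 : R else 0) \in @finitely_supported R X.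
Proof.
apply/asboolP; apply: (@sub_finite_set _ _ [set x]) (finite_set1 x) => y /=.
by case: asboolP.
Qed.

Definition fsunit (x : X) : fsmap R X := FsMap (fsunit_fin x).

Definition fsext (V : lmodType R) (b : X -> V) (p : fsmap R X) : V :=
  \sum_(x \in [set: X]) (p x : R) *: b x.

Definition fssupp (p : fsmap R X) : {fset X} := fset_set [set x | p x <> 0].

Lemma fssuppPn (p : fsmap R X) x : x \notin fssupp p -> p x = 0.
Proof.
have /asboolP fp := fsmap_fin p.
by rewrite /fssupp in_fset_set// notin_setE => /contrapT.
Qed.

Lemma fsextE (V : lmodType R) (b : X -> V) (p : fsmap R X) (A : {fset X}) :
  (forall x, x \notin A -> p x = 0) ->
  fsext b p = \sum_(x <- A) (p x : R) *: b x.
Proof. by move=> hA; apply: fsbigTE => x /hA ->; rewrite scale0r. Qed.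

Fact fsext_linear (V : lmodType R) (b : X -> V) : linear (fsext b).
Proof.
move=> a p q; pose A := (fssupp p `|` fssupp q)%fset.
have hp x : x \notin A -> p x = 0.
  by rewrite in_fsetU negb_or => /andP[/fssuppPn].
have hq x : x \notin A -> q x = 0.
  by rewrite in_fsetU negb_or => /andP[_ /fssuppPn].
rewrite (fsextE b hp) (fsextE b hq) (@fsextE V b _ A); last first.
  move=> x /[dup] /hp px /hq qx.
  by rewrite -[LHS]/(a *: p x + q x) px qx scaler0 addr0.
rewrite scaler_sumr -big_split /=; apply: eq_bigr => x _.
by rewrite -[_ x]/(a *: p x + q x) scalerDl scalerA.
Qed.

HB.instance Definition _ (V : lmodType R) (b : X -> V) :=
  GRing.isLinear.Build R (fsmap R X) V _ (fsext b) (fsext_linear b).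

Lemma fsext_unit (V : lmodType R) (b : X -> V) x : fsext b (fsunit x) = b x.
Proof.
rewrite (@fsextE V b _ [fset x]%fset).
  by rewrite big_seq_fset1 /=; case: asboolP => // _; rewrite scale1r.
by move=> y; rewrite inE /= => /eqP; case: asboolP.
Qed.

Lemma fsmap_sum (p : fsmap R X) : p = fsext fsunit p.
Proof.
apply: fsmapP => y; rewrite (fsextE _ (@fssuppPn p)).
pose ev (q : fsmap R X) : R := q y.
have evD : {morph ev : q r / q + r} by [].
rewrite -[RHS]/(ev _) (big_morph ev evD (erefl _)).
have [yp|/[dup] yp /fssuppPn ->] := boolP (y \in fssupp p); last first.
  rewrite big_seq big1// => x xp; rewrite /ev /=.
  rewrite -[LHS]/(p x * (if `[< y = x >] then 1 else 0) : R).
  by case: asboolP => [yx|_]; [rewrite -yx (negPf yp) in xp|rewrite mulr0].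
rewrite (big_fsetD1 y)//= big_seq big1 ?addr0.
  rewrite -[RHS]/(p y * (if `[< y = y >] then 1 else 0) : R).
  by case: asboolP => // _; rewrite mulr1.
move=> x; rewrite !inE => /andP[/eqP xy _].
rewrite -[LHS]/(p x * (if `[< y = x >] then 1 else 0) : R).
by case: asboolP => [yx|_]; [case: xy|rewrite mulr0].
Qed.

Lemma fsmap_ext (V : lmodType R) (f g : {linear fsmap R X -> V}) :
  (forall x, f (fsunit x) = g (fsunit x)) -> f =1 g.
Proof.
move=> fg p; rewrite [p]fsmap_sum (fsextE _ (@fssuppPn p)) !linear_sum.
by apply: eq_bigr => x _; rewrite !linearZ /= fg.
Qed.

End FsMapTheory.

Section Dual.
Variables (R : topRingType) (N : lmodType R).

Definition linear_form : {pred N -> selfmod R} := fun l => `[< linear l >].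

Fact linear_form_closed : submod_closed linear_form.
Proof.
split=> [|a l l' /asboolP ll /asboolP ll']; apply/asboolP => b u v.
  by rewrite -[RHS]/(b *: (0 : selfmod R) + 0) scaler0 addr0.
by rewrite !fctE ll ll' !scalerDr !scalerA mulrC addrACA.
Qed.

HB.instance Definition _ := GRing.isSubmodClosed.Build R (N -> selfmod R)
  linear_form linear_form_closed.

Record dual := Dual {
  dual_fun :> N -> selfmod R;
  dual_form : dual_fun \in linear_form
}.

HB.instance Definition _ := [isSub for dual_fun].
HB.instance Definition _ := [Choice of dual by <:].
HB.instance Definition _ := [SubChoice_isSubLmodule of dual by <:].

Fact dual_linear (l : dual) : linear l.
Proof. exact/asboolP/dual_form. Qed.

HB.instance Definition _ (l : dual) :=
  GRing.isLinear.Build R N (selfmod R) _ l (dual_linear l).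

Definition dual_eval (v : N) : dual -> selfmod R := fun l => l v.

Fact dual_eval_linear v : linear (dual_eval v).
Proof. by []. Qed.

HB.instance Definition _ v :=
  GRing.isLinear.Build R dual (selfmod R) _ (dual_eval v) (dual_eval_linear v).

HB.instance Definition _ :=
  Topological.copy dual (initial_family_topology dual_eval).

Lemma dual_eval_continuous v : continuous (dual_eval v).
Proof. exact: initial_family_continuous. Qed.

Lemma continuous_to_dual (Y : topologicalType) (h : Y -> dual) :
  (forall v, continuous (fun y => h y v)) -> continuous h.
Proof. exact: continuous_to_initial_family. Qed.

Lemma dualP (l l' : dual) : (forall v, dual_eval v l = dual_eval v l') -> l = l'.
Proof. by move=> ll'; apply: val_inj; apply: funext. Qed.

HB.instance Definition _ := isTopMod.Build R dual
  (initial_add_continuous dual_eval_continuous continuous_to_dual)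
  (initial_opp_continuous dual_eval_continuous continuous_to_dual)
  (initial_scale_continuous dual_eval_continuous continuous_to_dual)
  (initial_hausdorff dual_eval_continuous dualP).

End Dual.

Section TopDual.
Variables (R : topRingType) (M : topModType R).

Definition continuous_linear_form : {pred M -> selfmod R} :=
  fun l => `[< linear l /\ continuous l >].

Fact continuous_linear_form_closed : submod_closed continuous_linear_form.
Proof.
split=> [|a l l' /asboolP[ll cl] /asboolP[ll' cl']]; apply/asboolP; split.
- by move=> b u v; rewrite -[RHS]/(b *: (0 : selfmod R) + 0) scaler0 addr0.
- by move=> x; exact: cvg_cst.
- by move=> b u v; rewrite !fctE ll ll' !scalerDr !scalerA mulrC addrACA.
exact: continuous_linear_comb.
Qed.

HB.instance Definition _ := GRing.isSubmodClosed.Build R (M -> selfmod R)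
  continuous_linear_form continuous_linear_form_closed.

Record topdual := TopDual {
  topdual_fun :> M -> selfmod R;
  topdual_form : topdual_fun \in continuous_linear_form
}.

HB.instance Definition _ := [isSub for topdual_fun].
HB.instance Definition _ := [Choice of topdual by <:].
HB.instance Definition _ := [SubChoice_isSubLmodule of topdual by <:].

Fact topdual_linear (l : topdual) : linear l.
Proof. by have /asboolP[] := topdual_form l. Qed.

Lemma topdual_continuous (l : topdual) : continuous l.
Proof. by have /asboolP[] := topdual_form l. Qed.

HB.instance Definition _ (l : topdual) :=
  GRing.isLinear.Build R M (selfmod R) _ l (topdual_linear l).

Lemma topdualP (l l' : topdual) : l =1 l' -> l = l'.
Proof. by move=> ll'; apply: val_inj; apply: funext. Qed.

End TopDual.

Section Rigid.
Variable R : topRingType.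

Section Lambda.
Variables (X : choiceType) (p : fsmap R X).

Definition lambda_fun (f : rpow R X) : selfmod R :=
  \sum_(x \in [set: X]) (p x : R) * (f x : R).

Lemma lambda_funE f :
  lambda_fun f = \sum_(x <- fssupp p) (p x : R) *: f x.
Proof. exact: (fsextE (V := selfmod R) f (@fssuppPn R X p)). Qed.

Fact lambda_form : lambda_fun \in continuous_linear_form (M := rpow R X).
Proof.
apply/asboolP; split.
  move=> a f g; rewrite !lambda_funE scaler_sumr -big_split /=.
  by apply: eq_bigr => x _; rewrite scalerDr !scalerA mulrC.
have -> : lambda_fun = (fun f => \sum_(x <- fssupp p) (p x : R) *: f x).
  by apply: funext => f; exact: lambda_funE.
by apply: (@continuous_sum _ (rpow R X)) => x; exact: rpow_proj_continuous.
Qed.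

Definition lambda : topdual (rpow R X) := TopDual lambda_form.

End Lambda.

(* Every type is classically a choiceType, so X ranges over all sets; lambda  *)
(* is linear (lambda_linear), hence an isomorphism as soon as it is bijective.*)
Definition rigid : Prop := forall X : choiceType, bijective (@lambda X).

Lemma lambda_linear (X : choiceType) : linear (@lambda X).
Proof.
move=> a p q; apply: val_inj; apply: funext => f.
exact: (fsext_linear (V := selfmod R) f a p q).
Qed.

End Rigid.

(* The free module on M * N modulo the span of the bilinearity relations.     *)
Section Tensor.
Variables (R : topRingType) (M N : lmodType R).
Local Notation F := (fsmap R (M * N)).

Variant bilinearity_relation : F -> Prop :=
| RelDl m m' n : bilinearity_relation
    (fsunit R (m + m', n) - (fsunit R (m, n) + fsunit R (m', n)))
| RelDr m n n' : bilinearity_relation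
    (fsunit R (m, n + n') - (fsunit R (m, n) + fsunit R (m, n')))
| RelZl a m n : bilinearity_relation
    (fsunit R (a *: m, n) - a *: fsunit R (m, n))
| RelZr a m n : bilinearity_relation
    (fsunit R (m, a *: n) - a *: fsunit R (m, n)).

Definition bilinearity_span : {pred F} := fun p =>
  `[< forall S : {pred F}, submod_closed S ->
        (forall q, bilinearity_relation q -> q \in S) -> p \in S >].

Fact bilinearity_span_closed : submod_closed bilinearity_span.
Proof.
split=> [|a p q /asboolP hp /asboolP hq]; apply/asboolP => S Sc SR.
  by have [] := Sc.
by have [_ +] := Sc; apply; [exact: hp | exact: hq].
Qed.

HB.instance Definition _ := GRing.isSubmodClosed.Build R F
  bilinearity_span bilinearity_span_closed.

Definition tensor : Type := Quotient.quot (bilinearity_span : zmodClosed F).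

HB.instance Definition _ := GRing.Zmodule.on tensor.
HB.instance Definition _ := EqQuotient.on tensor.

Local Open Scope quotient_scope.

Lemma tensor_eqP (p q : F) :
  reflect (\pi_tensor p = \pi_tensor q) (p - q \in bilinearity_span).
Proof. by rewrite Quotient.idealrBE; exact: eqP. Qed.

Lemma tensor_piD (p q : F) :
  \pi_tensor (p + q) = \pi_tensor p + \pi_tensor q :> tensor.
Proof. by rewrite !piE. Qed.

Definition tensor_scale (a : R) (t : tensor) : tensor :=
  \pi_tensor (a *: repr t).

Lemma tensor_piZ a (p : F) :
  \pi_tensor (a *: p) = tensor_scale a (\pi_tensor p).
Proof.
apply/tensor_eqP; rewrite -scalerBr rpredZ//.
by apply/tensor_eqP; rewrite reprK.
Qed.

Fact tensor_scaleA a b t :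
  tensor_scale a (tensor_scale b t) = tensor_scale (a * b) t.
Proof. by rewrite -[t]reprK -(tensor_piZ b) -!tensor_piZ scalerA. Qed.
Fact tensor_scale1 : left_id 1 tensor_scale.
Proof. by move=> t; rewrite -[t]reprK -!tensor_piZ scale1r. Qed.
Fact tensor_scaleDr : right_distributive tensor_scale +%R.
Proof.
move=> a t u; rewrite -[t]reprK -[u]reprK.
by rewrite -tensor_piD -!tensor_piZ -tensor_piD scalerDr.
Qed.
Fact tensor_scaleDl t : {morph tensor_scale^~ t : a b / a + b}.
Proof.
move=> a b; rewrite -[t]reprK.
by rewrite -!tensor_piZ -tensor_piD scalerDl.
Qed.

HB.instance Definition _ := GRing.Zmodule_isLmodule.Build R tensor
  tensor_scaleA tensor_scale1 tensor_scaleDr tensor_scaleDl.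

Definition tensor_pi (p : F) : tensor := \pi_tensor p.

Fact tensor_pi_linear : linear tensor_pi.
Proof. by move=> a p q; rewrite /tensor_pi tensor_piD tensor_piZ. Qed.

HB.instance Definition _ :=
  GRing.isLinear.Build R F tensor _ tensor_pi tensor_pi_linear.

Lemma tensor_pi_surj (t : tensor) : exists p, t = tensor_pi p.
Proof. by exists (repr t); rewrite /tensor_pi reprK. Qed.

Definition pure (m : M) (n : N) : tensor := tensor_pi (fsunit R (m, n)).

Lemma bilinearity_pi q : bilinearity_relation q -> tensor_pi q = 0.
Proof.
move=> qR; rewrite -(linear0 tensor_pi); apply/tensor_eqP; rewrite subr0.
by apply/asboolP => S _; exact.
Qed.

Lemma pureDl m m' n : pure (m + m') n = pure m n + pure m' n.
Proof.
by apply/subr0_eq; rewrite -linearD -linearB; exact/bilinearity_pi/RelDl.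
Qed.
Lemma pureDr m n n' : pure m (n + n') = pure m n + pure m n'.
Proof.
by apply/subr0_eq; rewrite -linearD -linearB; exact/bilinearity_pi/RelDr.
Qed.
Lemma pureZl a m n : pure (a *: m) n = a *: pure m n.
Proof.
by apply/subr0_eq; rewrite -linearZ -linearB; exact/bilinearity_pi/RelZl.
Qed.
Lemma pureZr a m n : pure m (a *: n) = a *: pure m n.
Proof.
by apply/subr0_eq; rewrite -linearZ -linearB; exact/bilinearity_pi/RelZr.
Qed.

Definition bilin (V : lmodType R) (b : M -> N -> V) : Prop :=
  (forall n, linear (b^~ n)) /\ (forall m, linear (b m)).

Lemma pure_bilin : bilin pure.
Proof.
by split=> [n a m m'|m a n n']; rewrite (pureDl, pureDr) (pureZl, pureZr).
Qed.

Section Lift.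
Variables (V : lmodType R) (b : M -> N -> V).

Definition tensor_lift (t : tensor) : V :=
  fsext (fun mn => b mn.1 mn.2) (repr t).

Hypothesis bb : bilin b.

Lemma tensor_lift_pi p :
  tensor_lift (tensor_pi p) = fsext (fun mn => b mn.1 mn.2) p.
Proof.
pose f : {linear F -> V} := fsext (fun mn => b mn.1 mn.2).
rewrite -[RHS]/(f p) -[LHS]/(f (repr (tensor_pi p))); apply/subr0_eq; rewrite -linearB; apply/eqP.
have /tensor_eqP/asboolP : \pi_tensor (repr (tensor_pi p)) = \pi_tensor p.
  by rewrite reprK.
move=> /(_ [pred q | f q == 0]) hS; apply: hS; first split.
- by apply/eqP; rewrite linear0.
- move=> a u v /eqP fu /eqP fv; apply/eqP.
  by rewrite linearP [X in a *: X]fu [X in _ + X]fv scaler0 addr0.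
have [bl br] := bb.
move=> q qR; apply/eqP; case: qR => [m m' n|m n n'|a m n|a m n];
  rewrite linearB ?linearD ?linearZ /= /f !fsext_unit /=;
  rewrite -?opprD ?scalerN; apply/eqP; rewrite subr_eq0; apply/eqP.
- by have := bl n 1 m m'; rewrite !scale1r.
- by have := br m 1 n n'; rewrite !scale1r.
- have b0 : b 0 n = 0.
    by apply: (@addrI _ (b 0 n)); have := bl n 1 0 0; rewrite !scale1r !addr0.
  by have := bl n a m 0; rewrite b0 !addr0.
- have b0 : b m 0 = 0.
    by apply: (@addrI _ (b m 0)); have := br m 1 0 0; rewrite !scale1r !addr0.
  by have := br m a n 0; rewrite b0 !addr0.
Qed.

Lemma tensor_lift_pure m n : tensor_lift (pure m n) = b m n.
Proof. by rewrite tensor_lift_pi fsext_unit. Qed.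

Lemma tensor_lift_linear : linear tensor_lift.
Proof.
move=> a t u; have [p ->] := tensor_pi_surj t; have [q ->] := tensor_pi_surj u.
by rewrite -linearP !tensor_lift_pi; exact: fsext_linear.
Qed.

End Lift.

Lemma tensor_ext (V : lmodType R) (f g : tensor -> V) : linear f -> linear g ->
  (forall m n, f (pure m n) = g (pure m n)) -> f =1 g.
Proof.
move=> lf lg fg t; have [p ->] := tensor_pi_surj t.
have comp_lin (h : tensor -> V) : linear h -> linear (h \o tensor_pi).
  by move=> lh a u v; rewrite -[LHS]/(h (tensor_pi _)) linearP lh.
pose f' : {linear F -> V} := HB.pack (f \o tensor_pi)
  (GRing.isLinear.Build R F V _ _ (comp_lin _ lf)).
pose g' : {linear F -> V} := HB.pack (g \o tensor_pi)
  (GRing.isLinear.Build R F V _ _ (comp_lin _ lg)).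
by apply: (@fsmap_ext _ _ _ f' g') => -[m n]; exact: fg.
Qed.

End Tensor.

Section TopHom.
Variable R : topRingType.

Record tophom (M N : topModType R) := TopHom {
  tophom_fun :> M -> N;
  tophom_linear : linear tophom_fun;
  tophom_continuous : continuous tophom_fun
}.

HB.instance Definition _ (M N : topModType R) (f : tophom M N) :=
  GRing.isLinear.Build R M N _ f (tophom_linear f).

Lemma tophomP (M N : topModType R) (f g : tophom M N) : f =1 g -> f = g.
Proof.
case: f g => [f lf cf] [g lg cg] /= /funext fg; rewrite -{}fg in lg cg *.
by congr TopHom; exact: Prop_irrelevance.
Qed.

Definition tophom_id (M : topModType R) : tophom M M :=
  @TopHom M M idfun (fun a u v => erefl) (fun x => @cvg_id _ (nbhs x)).

Fact tophom_comp_linear (M N P : topModType R)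
  (g : tophom N P) (f : tophom M N) : linear (g \o f).
Proof. by move=> a u v; rewrite /= !linearP. Qed.

Fact tophom_comp_continuous (M N P : topModType R)
  (g : tophom N P) (f : tophom M N) : continuous (g \o f).
Proof.
by move=> x; apply: continuous_comp; exact: tophom_continuous.
Qed.

Definition tophom_comp (M N P : topModType R)
    (g : tophom N P) (f : tophom M N) : tophom M P :=
  TopHom (tophom_comp_linear g f) (@tophom_comp_continuous _ _ _ g f).

Fact tophom_compA (M N P Q : topModType R)
    (h : tophom P Q) (g : tophom N P) (f : tophom M N) :
  tophom_comp h (tophom_comp g f) = tophom_comp (tophom_comp h g) f.
Proof. exact: tophomP. Qed.

Fact tophom_comp1m (M N : topModType R) (f : tophom M N) :
  tophom_comp (tophom_id N) f = f.
Proof. exact: tophomP. Qed.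

Fact tophom_compm1 (M N : topModType R) (f : tophom M N) :
  tophom_comp f (tophom_id M) = f.
Proof. exact: tophomP. Qed.

Definition TopModCat : category :=
  Category tophom_compA tophom_comp1m tophom_compm1.

Definition topologically_free (M : TopModCat) : Prop :=
  exists X : choiceType, @isomorphic TopModCat M (rpow R X).

Definition TopFreeModCat : category := full_subcategory topologically_free.

Section TopDualMap.
Variables (M N : topModType R) (f : tophom M N).

Fact topdual_map_form (l : topdual N) :
  (l : N -> selfmod R) \o f \in continuous_linear_form (M := M).
Proof.
apply/asboolP; split=> [a u v|x]; first by rewrite /= !linearP.
by apply: continuous_comp; [exact: tophom_continuous | exact: topdual_continuous].
Qed.

Definition topdual_map (l : topdual N) : topdual M :=
  TopDual (topdual_map_form l).

Fact topdual_map_linear : linear topdual_map.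
Proof. by move=> a l l'; apply: topdualP. Qed.

HB.instance Definition _ := GRing.isLinear.Build R (topdual N) (topdual M) _
  topdual_map topdual_map_linear.
End TopDualMap.

Section DualMap.
Variables (P Q : lmodType R) (f : {linear P -> Q}).

Fact dual_map_form (l : dual Q) :
  (l : Q -> selfmod R) \o f \in linear_form (N := P).
Proof. by apply/asboolP => a u v; rewrite /= !linearP. Qed.

Definition dual_map_fun (l : dual Q) : dual P := Dual (dual_map_form l).

Fact dual_map_linear : linear dual_map_fun.
Proof. by move=> a l l'; apply: dualP. Qed.

Fact dual_map_continuous : continuous dual_map_fun.
Proof. by apply: continuous_to_dual => v; exact: dual_eval_continuous. Qed.

Definition dual_map : tophom (dual Q) (dual P) :=
  TopHom dual_map_linear dual_map_continuous.
End DualMap.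

Section TensorMap.
Variables (M1 M2 N1 N2 : lmodType R).
Variables (f1 : {linear M1 -> N1}) (f2 : {linear M2 -> N2}).

Definition tensor_map : tensor M1 M2 -> tensor N1 N2 :=
  tensor_lift (fun m1 m2 => pure (f1 m1) (f2 m2)).

Fact tensor_map_bilin : bilin (fun m1 m2 => pure (f1 m1) (f2 m2)).
Proof.
by split=> [n a m m'|m a n n']; rewrite linearP (pureDl, pureDr) (pureZl, pureZr).
Qed.

Lemma tensor_map_pure m1 m2 : tensor_map (pure m1 m2) = pure (f1 m1) (f2 m2).
Proof. exact: (tensor_lift_pure tensor_map_bilin). Qed.

HB.instance Definition _ :=
  GRing.isLinear.Build R (tensor M1 M2) (tensor N1 N2) _ tensor_map
    (tensor_lift_linear tensor_map_bilin).
End TensorMap.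

Definition toptensor (M N : topModType R) : topModType R :=
  dual (tensor (topdual M) (topdual N)).

Definition toptensor_map (M1 M2 N1 N2 : topModType R)
    (f1 : tophom M1 N1) (f2 : tophom M2 N2) :
    tophom (toptensor M1 M2) (toptensor N1 N2) :=
  dual_map (tensor_map (topdual_map f1) (topdual_map f2)).

Section TopPure.
Variables (M N : topModType R) (u : M) (v : N).

Definition toppure_fun : tensor (topdual M) (topdual N) -> selfmod R :=
  tensor_lift (fun (l1 : topdual M) (l2 : topdual N) => (l1 u : R) *: l2 v).

Fact toppure_bilin :
  bilin (fun (l1 : topdual M) (l2 : topdual N) => (l1 u : R) *: l2 v).
Proof.
split=> [n a m m'|m a n n'].
  by rewrite -[LHS]/((a * m u + m' u : R) *: n v) scalerDl scalerA.
by rewrite -[LHS]/((m u : R) *: (a *: n v + n' v)) scalerDr !scalerA mulrC.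
Qed.

Fact toppure_form : toppure_fun \in linear_form (N := _).
Proof. by apply/asboolP; exact: (tensor_lift_linear toppure_bilin). Qed.

Definition toppure : toptensor M N := Dual toppure_form.

Lemma toppureE (l1 : topdual M) (l2 : topdual N) :
  toppure (pure l1 l2) = (l1 u : R) *: l2 v.
Proof. exact: (tensor_lift_pure toppure_bilin). Qed.
End TopPure.

End TopHom.

Section FsextTheory.
Variables (R : topRingType) (X : choiceType) (V : lmodType R).

Lemma fsext_comb (a : R) (b b' : X -> V) (p : fsmap R X) :
  fsext (fun x => a *: b x + b' x) p = a *: fsext b p + fsext b' p.
Proof.
rewrite !(fsextE _ (@fssuppPn _ _ p)) scaler_sumr -big_split /=.
by apply: eq_bigr => x _; rewrite scalerDr !scalerA mulrC.
Qed.

Lemma linear_fsext (W : lmodType R) (f : V -> W) (b : X -> V) (p : fsmap R X) :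
  linear f -> f (fsext b p) = fsext (f \o b) p.
Proof.
move=> lf; pose fl : {linear V -> W} := HB.pack f (GRing.isLinear.Build R V W _ _ lf).
rewrite !(fsextE _ (@fssuppPn _ _ p)) -[f]/(fl : V -> W) linear_sum.
by apply: eq_bigr => x _; rewrite linearZ.
Qed.

Lemma continuous_fsext (Y : topologicalType) (W : topModType R)
    (b : Y -> X -> W) (p : fsmap R X) :
  (forall x, continuous (b^~ x)) -> continuous (fun y => fsext (b y) p).
Proof.
move=> cb; under eq_fun do rewrite (fsextE _ (@fssuppPn _ _ p)).
exact: (continuous_sum (f := fun x y => b y x)).
Qed.

End FsextTheory.

Section ToptensorFree.
Variable R : topRingType.
Hypothesis hR : rigid R.

Lemma lambda_unit (X : choiceType) (x : X) (f : rpow R X) :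
  lambda (fsunit R x) f = f x.
Proof. exact: (fsext_unit (V := selfmod R) f x). Qed.

(* A dual basis, and its coordinate maps, of M' for M topologically free. *)
Lemma topdual_basis (M : topModType R) (X : choiceType)
    (f : tophom M (rpow R X)) (g : tophom (rpow R X) M) :
  cancel f g -> cancel g f ->
  exists (e : X -> topdual M) (c : topdual M -> fsmap R X),
    [/\ linear c, forall x, c (e x) = fsunit R x &
        forall l, l = fsext e (c l)].
Proof.
move=> fK gK; have [li liK Kli] := hR X.
pose c (l : topdual M) := li (topdual_map g l).
pose e x := topdual_map f (lambda (fsunit R x)).
exists e, c; split=> [a l l'|x|l].
- apply: (can_inj liK); rewrite lambda_linear /c !Kli.
  exact: topdual_map_linear.
- apply: (can_inj liK); rewrite /c Kli; apply: topdualP => h.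
  by rewrite /= gK.
have lin : linear (fun p => topdual_map f (lambda (X := X) p)).
  by move=> a p q; rewrite lambda_linear topdual_map_linear.
transitivity (topdual_map f (lambda (c l))).
  by rewrite /c Kli; apply: topdualP => m; rewrite /= fK.
by rewrite {1}[c l]fsmap_sum (linear_fsext _ _ lin).
Qed.

Lemma toptensor_free (M N : topModType R) :
  topologically_free (M : TopModCat R) -> topologically_free (N : TopModCat R) ->
  topologically_free (toptensor M N : TopModCat R).
Proof.
move=> [X [f [f' [ff' f'f]]]] [Y [g [g' [gg' g'g]]]].
have cancelP (A B : topModType R) (u : tophom A B) (v : tophom B A) :
    tophom_comp u v = tophom_id B -> cancel v u.
  by move=> uv x; rewrite -[LHS]/(tophom_comp u v x) uv.
have [e1 [c1 [lc1 ce1 ec1]]] := topdual_basis (cancelP _ _ _ _ ff') (cancelP _ _ _ _ f'f).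
have [e2 [c2 [lc2 ce2 ec2]]] := topdual_basis (cancelP _ _ _ _ gg') (cancelP _ _ _ _ g'g).
pose T := tensor (topdual M) (topdual N).
pose b (h : X * Y -> selfmod R) l1 l2 : selfmod R :=
  fsext (fun x => fsext (fun y => h (x, y)) (c2 l2)) (c1 l1).
have bb h : bilin (b h).
  split=> [n a m m'|m a n n']; first by rewrite /b lc1 fsext_linear.
  rewrite /b -fsext_comb; congr fsext; apply: funext => x.
  by rewrite lc2 fsext_linear.
pose phi (L : toptensor M N) : rpow R (X * Y) :=
  fun xy => L (pure (e1 xy.1) (e2 xy.2)).
have phi_lin : linear phi by [].
have phi_cont : continuous phi.
  by apply: continuous_to_rpow => xy; exact: dual_eval_continuous.
have psi_form h : tensor_lift (b h) \in linear_form (N := T).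
  by apply/asboolP; exact: (tensor_lift_linear (bb h)).
pose psi (h : rpow R (X * Y)) : toptensor M N := Dual (psi_form h).
have psi_lin : linear psi.
  move=> a h h'; apply: dualP => t.
  rewrite -[RHS]/(a *: psi h t + psi h' t) /= /dual_eval /= /tensor_lift.
  rewrite -fsext_comb; congr fsext; apply: funext => -[l1 l2] /=.
  rewrite /b -fsext_comb; congr fsext; apply: funext => x.
  by rewrite -fsext_comb.
have psi_cont : continuous psi.
  apply: continuous_to_dual => t; apply: continuous_fsext => -[l1 l2] /=.
  apply: continuous_fsext => x; apply: continuous_fsext => y.
  exact: rpow_proj_continuous.
exists (X * Y)%type, (TopHom phi_lin phi_cont), (TopHom psi_lin psi_cont).
split; [apply: tophomP => L /= | apply: tophomP => h /=].
  apply: dualP => t; rewrite /dual_eval.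
  apply: (@tensor_ext _ _ _ _ (psi (phi L)) L (dual_linear _) (dual_linear _)).
  move=> l1 l2; rewrite /= (tensor_lift_pure (bb _)) /b /phi /=.
  rewrite [in RHS](ec1 l1) (linear_fsext _ _ ((pure_bilin _ _).1 l2)).
  rewrite (linear_fsext _ _ (dual_linear L)); congr fsext; apply: funext => x /=.
  rewrite [in RHS](ec2 l2) (linear_fsext _ _ ((pure_bilin _ _).2 (e1 x))).
  by rewrite (linear_fsext _ _ (dual_linear L)).
apply: funext => -[x y]; rewrite /phi /= (tensor_lift_pure (bb _)) /b.
by rewrite ce1 ce2 !fsext_unit.
Qed.

Lemma selfmod_free : topologically_free (selfmod R : TopModCat R).
Proof.
have c1 : continuous (fun a : selfmod R => (fun=> a) : rpow R unit).
  by apply: continuous_to_rpow => x a; exact: cvg_id.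
exists unit.
exists (@TopHom R (selfmod R) (rpow R unit) (fun a => fun=> a)
  (fun _ _ _ => erefl) c1).
exists (@TopHom R (rpow R unit) (selfmod R) (fun f => f tt)
  (fun _ _ _ => erefl) (@rpow_proj_continuous R unit tt)).
by split; apply: tophomP => f //=; apply: funext => -[].
Qed.

Definition topfree_tensor : tensor_data (TopFreeModCat R) :=
  @TensorData (TopFreeModCat R)
    (fun A B => exist (@topologically_free R) (toptensor (sval A) (sval B))
       (toptensor_free (svalP A) (svalP B)))
    (fun A A' B B' f g => toptensor_map f g)
    (exist (@topologically_free R) (selfmod R : topModType R) selfmod_free).

Record canonical_constraints (k : constraints topfree_tensor) : Prop :=
  CanonicalConstraints {
  canonical_assoc : forall (A B D : TopFreeModCat R)
      (u : sval A) (v : sval B) (w : sval D),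
    (cassoc k A B D : tophom _ _) (toppure (toppure u v) w)
    = toppure u (toppure v w);
  canonical_lunit : forall (A : TopFreeModCat R) (v : sval A),
    (clunit k A : tophom _ _) (toppure ((1 : R) : selfmod R) v) = v;
  canonical_runit : forall (A : TopFreeModCat R) (u : sval A),
    (crunit k A : tophom _ _) (toppure u ((1 : R) : selfmod R)) = u;
  canonical_sym : forall (A B : TopFreeModCat R) (u : sval A) (v : sval B),
    (csym k A B : tophom _ _) (toppure u v) = toppure v u
}.

End ToptensorFree.

(* Main.v *)
(* Write M @ N for the topological tensor product (M' (x) N')^*.  By rigidity,
   every continuous linear form on M @ N is the evaluation at an element of
   M' (x) N', and the vectors u @ v separate the elements of M' (x) N'.  Hence
   a morphism from an iterated tensor product to a topologically free module is
   determined by its values on iterated pure tensors, and a map given on pure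
   tensors extends to a morphism as soon as its composite with each continuous
   form of the target extends to a continuous form.  This gives existence and
   uniqueness of the constraints, and reduces each coherence axiom to a
   computation on pure tensors. *)
From mathcomp Require Import all_boot all_algebra.
From mathcomp Require Import all_classical.
From mathcomp Require Import topology_structure product_topology.
Require Import Defs.

Set Implicit Arguments.
Unset Strict Implicit.
Unset Printing Implicit Defensive.

Import GRing.Theory.
Local Open Scope classical_set_scope.
Local Open Scope ring_scope.
Local Open Scope cat_scope.

(** * Coordinates on tensor products, and continuous forms on weak-star duals *)

Section Forms.
Variable R : topRingType.

(* e need not be free: c is some linear choice of coordinates along e. *)
Definition spans (V : lmodType R) (Z : choiceType) (e : Z -> V)
    (c : V -> fsmap R Z) : Prop :=
  linear c /\ forall v, v = fsext e (c v).

Lemma eq_fsext (X : choiceType) (V : lmodType R) (b b' : X -> V)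
    (p : fsmap R X) :
  b =1 b' -> fsext b p = fsext b' p.
Proof. by move=> /funext ->. Qed.

Lemma fsunitC (X : choiceType) (x y : X) : fsunit R x y = fsunit R y x.
Proof. by rewrite /=; do 2 case: asboolP => //; congruence. Qed.

Lemma fsunit_pair (X Y : choiceType) (x x' : X) (y y' : Y) :
  fsunit R (x', y') (x, y) = (fsunit R x' x : R) *: fsunit R y' y.
Proof.
rewrite /=; case: (asboolP (x = x')) => [->|xx].
  rewrite scale1r; case: (asboolP (y = y')) => [->|yy].
    by rewrite asboolT.
  by rewrite asboolF// => -[].
by rewrite asboolF ?scale0r// => -[].
Qed.

Fact fseval_linear (X : Type) (x : X) :
  linear (fun p : fsmap R X => p x : selfmod R).
Proof. by []. Qed.

Lemma fsext_unit_eval (X : choiceType) (p : fsmap R X) (x : X) :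
  fsext (fun y => fsunit R y x : selfmod R) p = p x.
Proof. by rewrite {2}[p]fsmap_sum (linear_fsext _ _ (fseval_linear x)). Qed.

Lemma tensor_ind (M N : lmodType R) (P : tensor M N -> Prop) :
  P 0 -> (forall a t u, P t -> P u -> P (a *: t + u)) ->
  (forall m n, P (pure m n)) -> forall t, P t.
Proof.
move=> P0 PD Pp t; have [p ->] := tensor_pi_surj t.
rewrite [p]fsmap_sum (linear_fsext _ _ (@tensor_pi_linear _ _ _)).
rewrite (fsextE _ (@fssuppPn _ _ p)).
apply: big_rec => // -[m n] u _ Pu; apply: PD => //; exact: Pp.
Qed.

(** Products of coordinates are bilinear, hence factor through the tensor product. The formula on
    pure tensors serves to recognise these coordinates later as evaluations against elementary
    tensors. *)
Lemma tensor_spans (V W : lmodType R) (X Y : choiceType)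
    (e : X -> V) (c : V -> fsmap R X) (e' : Y -> W) (c' : W -> fsmap R Y) :
  spans e c -> spans e' c' ->
  exists C : tensor V W -> fsmap R (X * Y),
    spans (fun z => pure (e z.1) (e' z.2)) C /\
    forall v w x y, C (pure v w) (x, y) = (c v x : R) *: c' w y.
Proof.
move=> [lc ec] [lc' ec'].
pose b v w := fsext (fun x => fsext (fun y => fsunit R (x, y)) (c' w)) (c v).
have bb : bilin b.
  split=> [n a m m'|m a n n']; first by rewrite /b lc fsext_linear.
  rewrite /b -fsext_comb; apply: eq_fsext => x.
  by rewrite lc' fsext_linear.
exists (tensor_lift b); split; first split; first exact: tensor_lift_linear.
  apply: tensor_ext => //.
    move=> a t u; rewrite (tensor_lift_linear bb); exact: fsext_linear.
  move=> v w; rewrite (tensor_lift_pure bb) /b.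
  have lext := fsext_linear (fun z : X * Y => pure (e z.1) (e' z.2)).
  rewrite (linear_fsext _ _ lext) {1}[v]ec.
  rewrite (linear_fsext _ _ ((pure_bilin _ _).1 w)).
  apply: eq_fsext => x /=.
  rewrite (linear_fsext _ _ lext) {1}[w]ec'.
  rewrite (linear_fsext _ _ ((pure_bilin _ _).2 (e x))).
  by apply: eq_fsext => y /=; rewrite fsext_unit.
move=> v w x y; rewrite (tensor_lift_pure bb) /b.
rewrite (linear_fsext _ _ (fseval_linear (x, y))).
(* The inner sum is collapsed first: only [y] contributes, which leaves a multiple of
   [fsunit R x' x]. *)
transitivity (fsext (fun x' => (c' w y : R) *: (fsunit R x' x : selfmod R)) (c v)).
  apply: eq_fsext => x' /=.
  rewrite (linear_fsext _ _ (fseval_linear (x, y))).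
  rewrite -[RHS]/((c' w y : R) * (fsunit R x' x : R)) mulrC.
  rewrite -(fsext_unit_eval (c' w) y).
  rewrite -[RHS]/((fsunit R x' x : R) *: (_ : selfmod R)).
  have sl : linear (fun t : selfmod R => (fsunit R x' x : R) *: t).
    by move=> a t u; rewrite scalerDr !scalerA mulrC.
  rewrite (linear_fsext _ _ sl).
  by apply: eq_fsext => y' /=; exact: fsunit_pair.
have sl : linear (fun t : selfmod R => (c' w y : R) *: t).
  by move=> a t u; rewrite scalerDr !scalerA mulrC.
rewrite -(linear_fsext _ _ sl) fsext_unit_eval.
by rewrite -[LHS]/((_ : R) * _) mulrC.
Qed.

Section DualForm.
Variables (V : lmodType R) (v : V).

Fact dual_form_at_form : dual_eval v \in continuous_linear_form (M := dual V).
Proof. by apply/asboolP; split=> //; exact: dual_eval_continuous. Qed.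

Definition dual_form_at : topdual (dual V) := TopDual dual_form_at_form.

End DualForm.

Hypothesis hR : rigid R.

(** Rigidity speaks of [rpow R Z], so [phi] is pulled back along a continuous linear map from there
    to [dual V]; the finitely supported [p] obtained gives the vector [fsext e p]. *)
Lemma dual_form_surj (V : lmodType R) (Z : choiceType) (e : Z -> V) c :
  spans e c -> forall phi : topdual (dual V), exists v, phi = dual_form_at v.
Proof.
move=> [lc ec] phi.
have psi_form h : (fun v => fsext h (c v)) \in linear_form (N := V).
  by apply/asboolP => a u v; rewrite lc fsext_linear.
(* As [e] may fail to be free, [psi h] may differ from [h z] at [e z]; the identity used below is
   [psi (L \o e) = L] for a form [L]. *)
pose psi (h : rpow R Z) : dual V := Dual (psi_form h).
have psi_lin : linear psi.
  by move=> a h h'; apply: dualP => v; exact: fsext_comb.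
have psi_cont : continuous psi.
  apply: continuous_to_dual => v; apply: continuous_fsext => z.
  exact: rpow_proj_continuous.
have [li liK Kli] := hR Z.
pose p := li (topdual_map (TopHom psi_lin psi_cont) phi).
exists (fsext e p); apply: topdualP => L.
have -> : phi L = lambda p (fun z => L (e z)).
  rewrite Kli /=; congr (phi _); apply: dualP => v.
  rewrite -[RHS]/(fsext (L \o e) (c v)) -(linear_fsext _ _ (dual_linear L)).
  by rewrite -ec.
by rewrite /= /dual_eval (linear_fsext _ _ (dual_linear L)).
Qed.

Lemma topfreeP (M : topModType R) : topologically_free (M : TopModCat R) ->
  exists (X : choiceType) (f : tophom M (rpow R X)) (g : tophom (rpow R X) M),
    cancel f g /\ cancel g f.
Proof.
move=> [X [f [g [gf fg]]]]; exists X, f, g; split=> x.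
- by rewrite -[LHS]/((g \oc f : tophom _ _) x) gf.
- by rewrite -[LHS]/((f \oc g : tophom _ _) x) fg.
Qed.

(** Rigidity carries the canonical basis of finitely supported maps over to [topdual M]. The points
    [u x] are unit vectors transported to [M]; they turn the coordinates of a form into its
    values. *)
Lemma topdual_spans (M : topModType R) : topologically_free (M : TopModCat R) ->
  exists (X : choiceType) (e : X -> topdual M) c (u : X -> M),
    spans e c /\ forall l x, c l x = l (u x).
Proof.
move=> /topfreeP[X [f [g [fK gK]]]]; have [li liK Kli] := hR X.
pose c (l : topdual M) := li (topdual_map g l).
exists X, (fun x => topdual_map f (lambda (fsunit R x))), c,
  (fun x => g (fsunit R x)); split; first split.
- move=> a l l'; apply: (can_inj liK).
  by rewrite lambda_linear /c !Kli; exact: topdual_map_linear.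
- move=> l.
  have lin : linear (fun p => topdual_map f (lambda (X := X) p)).
    by move=> a p q; rewrite lambda_linear topdual_map_linear.
  transitivity (topdual_map f (lambda (c l))).
    by rewrite /c Kli; apply: topdualP => m; rewrite /= fK.
  by rewrite {1}[c l]fsmap_sum (linear_fsext _ _ lin).
(* By rigidity [l \o g] is [lambda (c l)], whose value at a unit vector is the corresponding
   coordinate of [c l]. *)
- move=> l x; rewrite -[RHS]/(topdual_map g l (fsunit R x)) -(Kli (topdual_map g l)) -/(c l).
  rewrite -fsext_unit_eval; by apply: eq_fsext => y; exact: fsunitC.
Qed.

End Forms.

(** * Elementary tensors as morphisms in each factor, and total families *)

Section TopPureTheory.
Variable R : topRingType.

Lemma toppure_linearl (M N : topModType R) (v : N) :
  linear (fun u : M => toppure u v).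
Proof.
move=> a u u'; apply: dualP.
have lL := dual_linear (a *: toppure u v + toppure u' v).
apply: (tensor_ext (dual_linear (toppure (a *: u + u') v)) lL) => l1 l2.
rewrite toppureE linearP.
rewrite -[RHS]/(a *: toppure u v (pure l1 l2) + toppure u' v (pure l1 l2)).
by rewrite !toppureE -[X in X *: _]/(a * (l1 u : R) + (l1 u' : R)) scalerDl scalerA.
Qed.

Lemma toppure_linearr (M N : topModType R) (u : M) :
  linear (fun v : N => toppure u v).
Proof.
move=> a v v'; apply: dualP.
have lL := dual_linear (a *: toppure u v + toppure u v').
apply: (tensor_ext (dual_linear (toppure u (a *: v + v'))) lL) => l1 l2.
rewrite toppureE linearP.
rewrite -[RHS]/(a *: toppure u v (pure l1 l2) + toppure u v' (pure l1 l2)).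
by rewrite !toppureE scalerDr !scalerA mulrC.
Qed.

(** The target topology is initial for evaluations at tensors, and continuity passes to linear
    combinations, so pure tensors suffice. *)
Lemma toppure_continuousl (M N : topModType R) (v : N) :
  continuous (fun u : M => toppure u v).
Proof.
apply: continuous_to_dual; apply: tensor_ind => [|a t t' ct ct'|l1 l2].
- by under eq_fun do rewrite linear0; move=> u; exact: cvg_cst.
- by under eq_fun do rewrite linearP; exact: continuous_linear_comb.
(* Commutativity makes the constant [l2 v] the scalar; adding the zero function gives the shape
   [a *: f + g]. *)
- under eq_fun do rewrite toppureE -[_ *: _]/((_ : R) * (_ : R)) mulrC.
  have c0 : continuous (fun _ : M => 0 : selfmod R).
    by move=> u; exact: cvg_cst.
  have := continuous_linear_comb (a := l2 v : R) (topdual_continuous (l := l1)) c0.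
  by under eq_fun do rewrite addr0.
Qed.

Lemma toppure_continuousr (M N : topModType R) (u : M) :
  continuous (fun v : N => toppure u v).
Proof.
apply: continuous_to_dual; apply: tensor_ind => [|a t t' ct ct'|l1 l2].
- by under eq_fun do rewrite linear0; move=> v; exact: cvg_cst.
- by under eq_fun do rewrite linearP; exact: continuous_linear_comb.
- under eq_fun do rewrite toppureE.
  have c0 : continuous (fun _ : N => 0 : selfmod R).
    by move=> v; exact: cvg_cst.
  have := continuous_linear_comb (a := l1 u : R) (topdual_continuous (l := l2)) c0.
  by under eq_fun do rewrite addr0.
Qed.

(** The suffix names the factor that varies. Pulling a form back along these maps freezes the other
    factor; at 1 they invert the unit constraints. *)
Definition toppurel (M N : topModType R) (v : N) : tophom M (toptensor M N) :=
  TopHom (toppure_linearl v) (@toppure_continuousl M N v).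

Definition toppurer (M N : topModType R) (u : M) : tophom N (toptensor M N) :=
  TopHom (toppure_linearr u) (@toppure_continuousr M N u).

Lemma toptensor_map_pure (M M' N N' : topModType R) (f : tophom M M')
    (g : tophom N N') (u : M) (v : N) :
  toptensor_map f g (toppure u v) = toppure (f u) (g v).
Proof.
apply: dualP; apply: (tensor_ext (dual_linear _) (dual_linear _)) => l1 l2.
rewrite toppureE -[LHS]/(toppure u v (tensor_map _ _ (pure l1 l2))).
by rewrite tensor_map_pure toppureE.
Qed.

(* In place of a density argument: forms, rather than the topology, detect *)
(* that the family G is large.                                             *)
Definition total (I : Type) (M : topModType R) (G : I -> M) : Prop :=
  forall l l' : topdual M, (forall i, l (G i) = l' (G i)) -> l = l'.

Lemma total_id (M : topModType R) : total (fun u : M => u).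
Proof. by move=> l l'; exact: topdualP. Qed.

(** Every scalar is a multiple of 1. This is why the unit axioms can be tested at 1 alone. *)
Lemma total_one : total (fun _ : unit => (1 : R) : selfmod R).
Proof.
move=> l l' /(_ tt) ll'; apply: topdualP => a.
have -> : a = (a : R) *: ((1 : R) : selfmod R).
  by rewrite -[RHS]/((a : R) * 1) mulr1.
by rewrite !linearZ; congr (_ *: _).
Qed.

(** The coordinates of [P] separate its points, and each one composed with [f] or [g] is a
    continuous form on [M], to which totality applies. *)
Lemma total_ext (I : Type) (M P : topModType R) (G : I -> M)
    (f g : tophom M P) :
  topologically_free (P : TopModCat R) -> total G ->
  (forall i, f (G i) = g (G i)) -> f = g.
Proof.
move=> /topfreeP[X [h [h' [hK _]]]] tG fg; apply: tophomP => m.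
apply: (can_inj hK); apply: funext => x.
pose pr : topdual P := topdual_map h (lambda (fsunit R x)).
have prE p : pr p = h p x by exact: lambda_unit.
rewrite -!prE -[LHS]/(topdual_map f pr m) -[RHS]/(topdual_map g pr m).
suff -> : topdual_map f pr = topdual_map g pr by [].
by apply: tG => i; rewrite /= fg.
Qed.

(** A morphism into [rpow R X] is a family of continuous forms, so it is enough to choose a [psi]
    for each coordinate of [P]. *)
Lemma topfree_extend (I : Type) (M P : topModType R) (G : I -> M) (b : I -> P) :
  topologically_free (P : TopModCat R) ->
  (forall phi : topdual P, exists psi : topdual M, forall i,
     phi (b i) = psi (G i)) ->
  exists f : tophom M P, forall i, f (G i) = b i.
Proof.
move=> /topfreeP[X [h [h' [hK _]]]] hb.
have /choice[psi psiE] (x : X) : exists psi : topdual M, forall i,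
    h (b i) x = psi (G i).
  have [psi psiE] := hb (topdual_map h (lambda (fsunit R x))).
  by exists psi => i; rewrite -psiE; apply: esym; exact: lambda_unit.
pose k m : rpow R X := fun x => psi x m.
have k_lin : linear k.
  by move=> a m m'; apply: funext => x; rewrite /k linearP.
have k_cont : continuous k.
  by apply: continuous_to_rpow => x; exact: topdual_continuous.
exists (tophom_comp h' (TopHom k_lin k_cont)) => i.
by rewrite -[RHS]hK /=; congr (h' _); apply: funext => x /=; rewrite psiE.
Qed.

End TopPureTheory.

(** * Forms on tensor products of topologically free modules *)

Section FreeTensor.
Variables (R : topRingType) (hR : rigid R).

(** Each coordinate of a tensor is its evaluation against a single elementary tensor, so elementary
    tensors separate tensors of forms. *)
Lemma toptensor_spans (M N : topModType R) :
  topologically_free (M : TopModCat R) -> topologically_free (N : TopModCat R) ->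
  exists (Z : choiceType) (e : Z -> tensor (topdual M) (topdual N)) c (u : Z -> M * N),
    spans e c /\ forall t z, c t z = toppure (u z).1 (u z).2 t.
Proof.
move=> /(topdual_spans hR)[X [e [c [u [ec uc]]]]].
move=> /(topdual_spans hR)[Y [e' [c' [u' [ec' uc']]]]].
have [C [Cspans CE]] := tensor_spans ec ec'.
exists (X * Y)%type, (fun z => pure (e z.1) (e' z.2)), C,
  (fun z => (u z.1, u' z.2)); split=> // t [x y] /=; move: t.
have lC : linear (fun t => C t (x, y) : selfmod R).
  by move=> a t t'; rewrite Cspans.1.
apply: (tensor_ext lC (dual_linear (toppure (u x) (u' y)))) => l1 l2.
by rewrite CE toppureE uc uc'.
Qed.

(** Each form is the evaluation at some tensor and depends linearly on it, so induction on tensors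
    transfers to forms. *)
Lemma topdual_toptensor_ind (M N : topModType R)
    (P : topdual (toptensor M N) -> Prop) :
  topologically_free (M : TopModCat R) -> topologically_free (N : TopModCat R) ->
  P 0 -> (forall a l l', P l -> P l' -> P (a *: l + l')) ->
  (forall l1 l2, P (dual_form_at (pure l1 l2))) -> forall l, P l.
Proof.
move=> hM hN P0 PD Pp l.
have [Z [e [c [_ [ec _]]]]] := toptensor_spans hM hN.
have [t ->] := dual_form_surj hR ec l; move: t; apply: tensor_ind => //.
- by have -> : dual_form_at 0 = 0 :> topdual (toptensor M N);
    [apply: topdualP => L; exact: (linear0 L)|].
- move=> a t t' Pt Pt'; have -> : dual_form_at (a *: t + t') =
    a *: dual_form_at t + dual_form_at t' :> topdual (toptensor M N).
    by apply: topdualP => L; exact: (linearP L).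
  exact: PD.
Qed.

(** The two forms are evaluations at tensors [t] and [t'], whose coordinates are among the values on
    elementary tensors. *)
Lemma total_pure (M N : topModType R) :
  topologically_free (M : TopModCat R) -> topologically_free (N : TopModCat R) ->
  total (fun uv : M * N => toppure uv.1 uv.2).
Proof.
move=> hM hN l l'; have [Z [e [c [u [ec uc]]]]] := toptensor_spans hM hN.
have [t ->] := dual_form_surj hR ec l.
have [t' ->] := dual_form_surj hR ec l' => tt'.
rewrite [t]ec.2 [t']ec.2; congr (dual_form_at (fsext e _)).
by apply: fsmapP => z; rewrite !uc; exact: tt' (u z).
Qed.

(** Agreement spreads one factor at a time: from [G i] to all [u] with [H j] fixed, then from [H j]
    to all [v] with [u] fixed. *)
Lemma total_toppure (I J : Type) (M N : topModType R) (G : I -> M) (H : J -> N) :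
  topologically_free (M : TopModCat R) -> topologically_free (N : TopModCat R) ->
  total G -> total H -> total (fun ij => toppure (G ij.1) (H ij.2)).
Proof.
move=> hM hN tG tH l l' ll'; apply: (total_pure hM hN) => -[u v] /=.
have lG j : topdual_map (toppurel M (H j)) l = topdual_map (toppurel M (H j)) l'.
  by apply: tG => i; exact: (ll' (i, j)).
have lH : topdual_map (toppurer N u) l = topdual_map (toppurer N u) l'.
  by apply: tH => j; have /(congr1 (fun f => topdual_fun f u)) := lG j.
by have /(congr1 (fun f => topdual_fun f v)) := lH.
Qed.

End FreeTensor.

(** * Construction of the constraints *)

Section Constraints.
Variables (R : topRingType) (hR : rigid R).
Local Notation C := (TopFreeModCat R).
Local Notation T := (topfree_tensor hR).

(** [happ], [tpure] and [tone] keep the objects of [C] visible, so that the rewriting rules match on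
    categorical expressions. *)
Definition happ (A B : C) (f : hom A B) : sval A -> sval B :=
  tophom_fun (f : tophom _ _).

Definition tpure (A B : C) (u : sval A) (v : sval B) : sval (tens T A B) :=
  toppure u v.

Definition tone : sval (tunit T) := (1 : R).

Lemma hom_ext (A B : C) (I : Type) (G : I -> sval A) (f g : hom A B) :
  total G -> (forall i, happ f (G i) = happ g (G i)) -> f = g.
Proof. exact: total_ext (svalP B). Qed.

Lemma total_all (A : C) : total (fun u : sval A => u).
Proof. exact: total_id. Qed.

Lemma total_tone : total (fun _ : unit => tone).
Proof. exact: total_one. Qed.

Lemma total_tpure (A B : C) (I J : Type) (G : I -> sval A) (H : J -> sval B) :
  total G -> total H -> total (fun ij => tpure (G ij.1) (H ij.2)).
Proof. exact: (@total_toppure _ hR I J _ _ G H (svalP A) (svalP B)). Qed.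

Lemma total_tpure_all (A B : C) :
  total (fun i : sval A * sval B => tpure i.1 i.2).
Proof. exact: total_tpure (@total_all A) (@total_all B). Qed.

Lemma selfmod_mulA (a b c : selfmod R) :
  (((a : R) *: b : selfmod R) : R) *: c = (a : R) *: ((b : R) *: c).
Proof. by rewrite scalerA. Qed.

Lemma form_pureE (M N : topModType R) (l1 : topdual M) (l2 : topdual N) u v :
  (dual_form_at (pure l1 l2) : topdual (toptensor M N)) (toppure u v)
  = (l1 u : R) *: l2 v.
Proof. exact: toppureE. Qed.

(** Forms on the target are combinations of nested pure ones; rebracketing these gives the matching
    forms on the source, by associativity of scalar multiplication. *)
Lemma assoc_exists (A B D : C) :
  exists f : hom (tens T (tens T A B) D) (tens T A (tens T B D)),
    forall u v w, happ f (tpure (tpure u v) w) = tpure u (tpure v w).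
Proof.
suff [f fE] : exists f : tophom (sval (tens T (tens T A B) D))
    (sval (tens T A (tens T B D))), forall i : sval A * sval B * sval D,
    f (toppure (toppure i.1.1 i.1.2) i.2) = toppure i.1.1 (toppure i.1.2 i.2).
  by exists f => u v w; exact: (fE (u, v, w)).
apply: topfree_extend (svalP (tens T A (tens T B D))) _ => phi.
move: phi; apply: (topdual_toptensor_ind hR (svalP A) (svalP (tens T B D))).
- by exists 0.
- move=> a l l' [p pE] [p' pE']; exists (a *: p + p') => i.
  by rewrite -[LHS]/(a *: l _ + l' _) pE pE'.
(* The form on [tens T B D] paired with [l] is reduced in turn to a pure one. *)
move=> l; apply: (topdual_toptensor_ind hR (svalP B) (svalP D)).
- by exists 0 => i; rewrite form_pureE; exact: scaler0.
- move=> a l1 l2 [p pE] [p' pE']; exists (a *: p + p') => i.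
  rewrite -[RHS]/(a *: p _ + p' _) -pE -pE' !form_pureE.
  rewrite -[X in _ *: X]/(a *: l1 _ + l2 _).
  by rewrite scalerDr !scalerA mulrC.
- move=> l1 l2; exists (dual_form_at (pure (dual_form_at (pure l l1)) l2)).
  by move=> i; rewrite !form_pureE selfmod_mulA.
Qed.

Lemma sym_exists (A B : C) :
  exists f : hom (tens T A B) (tens T B A),
    forall u v, happ f (tpure u v) = tpure v u.
Proof.
suff [f fE] : exists f : tophom (sval (tens T A B)) (sval (tens T B A)),
    forall i : sval A * sval B, f (toppure i.1 i.2) = toppure i.2 i.1.
  by exists f => u v; exact: (fE (u, v)).
apply: topfree_extend (svalP (tens T B A)) _ => phi.
move: phi; apply: (topdual_toptensor_ind hR (svalP B) (svalP A)).
- by exists 0.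
- move=> a l l' [p pE] [p' pE']; exists (a *: p + p') => i.
  by rewrite -[LHS]/(a *: l _ + l' _) pE pE'.
- move=> l1 l2; exists (dual_form_at (pure l2 l1)) => i.
  by rewrite !form_pureE; exact: mulrC.
Qed.

Fact selfmod_id_form :
  (fun a => a) \in continuous_linear_form (M := selfmod R).
Proof. by apply/asboolP; split=> // x; exact: cvg_id. Qed.

Lemma lunit_exists (A : C) :
  exists f : hom (tens T (tunit T) A) A, forall v, happ f (tpure tone v) = v.
Proof.
apply: topfree_extend (svalP A) _ => phi.
(* On the unit factor the identity form is taken, with value 1 at [tone]. *)
exists (dual_form_at (pure (TopDual selfmod_id_form) phi)) => v.
by rewrite form_pureE; exact: (esym (scale1r _)).
Qed.

Lemma happ_id (A : C) (u : sval A) : happ (idm A) u = u.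
Proof. by []. Qed.

Lemma happ_comp (A B D : C) (g : hom B D) (f : hom A B) u :
  happ (g \oc f) u = happ g (happ f u).
Proof. by []. Qed.

Lemma happ_tensm (A A' B B' : C) (f : hom A A') (g : hom B B') u v :
  happ (tensm T f g) (tpure u v) = tpure (happ f u) (happ g v).
Proof. exact: toptensor_map_pure. Qed.

Definition lunit_inv (A : C) : hom A (tens T (tunit T) A) :=
  toppurer (sval A) tone.

Lemma happ_lunit_inv (A : C) u : happ (lunit_inv A) u = tpure tone u.
Proof. by []. Qed.

Definition runit_inv (A : C) : hom A (tens T A (tunit T)) :=
  toppurel (sval A) tone.

Lemma happ_runit_inv (A : C) u : happ (runit_inv A) u = tpure u tone.
Proof. by []. Qed.

(** * Coherence axioms *)

Section Canonical.
Variable k : constraints T.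
Hypothesis kc : canonical_constraints k.

Lemma happ_assoc (A B D : C) u v w :
  happ (cassoc k A B D) (tpure (tpure u v) w) = tpure u (tpure v w).
Proof. exact: (canonical_assoc kc). Qed.

Lemma happ_lunit (A : C) v : happ (clunit k A) (tpure tone v) = v.
Proof. exact: (canonical_lunit kc). Qed.

Lemma happ_runit (A : C) u : happ (crunit k A) (tpure u tone) = u.
Proof. exact: (canonical_runit kc). Qed.

Lemma happ_sym (A B : C) u v : happ (csym k A B) (tpure u v) = tpure v u.
Proof. exact: (canonical_sym kc). Qed.

Definition happE := (happ_comp, happ_tensm, happ_assoc, happ_lunit, happ_runit,
  happ_sym, happ_id).

Lemma canonical_symK (A B : C) : csym k B A \oc csym k A B = idm (tens T A B).
Proof. by apply: (hom_ext (@total_tpure_all A B)) => i; rewrite !happE. Qed.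

(* The inverse of the associator is built from the associator and symmetries. *)
Lemma canonical_monoidal : symmetric_monoidal k.
Proof.
have tt := total_all.
split.
- by move=> A B; apply: (hom_ext (@total_tpure_all A B)) => i; rewrite !happE.
- by move=> A A' A'' B B' B'' f' f g' g; apply: (hom_ext (@total_tpure_all A B)) => i;
    rewrite !happE.
- move=> A B D; exists (tensm T (csym k B A) (idm D) \oc csym k D (tens T B A)
    \oc cassoc k D B A \oc tensm T (csym k B D) (idm A)
    \oc csym k A (tens T B D)); split.
    by apply: (hom_ext (total_tpure (@total_tpure_all A B) (tt D))) => i; rewrite !happE.
  by apply: (hom_ext (total_tpure (tt A) (@total_tpure_all B D))) => i; rewrite !happE.
- move=> A; exists (lunit_inv A); split.
    by apply: (hom_ext (total_tpure total_tone (tt A))) => i;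
      rewrite !happE happ_lunit_inv.
  by apply: (hom_ext (tt A)) => u; rewrite happ_comp happ_lunit_inv !happE.
- move=> A; exists (runit_inv A); split.
    by apply: (hom_ext (total_tpure (tt A) total_tone)) => i;
      rewrite !happE happ_runit_inv.
  by apply: (hom_ext (tt A)) => u; rewrite happ_comp happ_runit_inv !happE.
- by move=> A B; exists (csym k B A); split; exact: canonical_symK.
- by move=> A A' B B' D D' f g h;
    apply: (hom_ext (total_tpure (@total_tpure_all A B) (tt D))) => i; rewrite !happE.
- by move=> A A' f; apply: (hom_ext (total_tpure total_tone (tt A))) => i;
    rewrite !happE.
- by move=> A A' f; apply: (hom_ext (total_tpure (tt A) total_tone)) => i;
    rewrite !happE.
- by move=> A A' B B' f g; apply: (hom_ext (@total_tpure_all A B)) => i; rewrite !happE.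
(* Both sides send ((u @ v) @ w) @ x to u @ (v @ (w @ x)). *)
- by move=> A B D E;
    apply: (hom_ext (total_tpure (total_tpure (@total_tpure_all A B) (tt D)) (tt E))) => i;
    rewrite !happE.
- by move=> A B;
    apply: (hom_ext (total_tpure (total_tpure (tt A) total_tone) (tt B))) => i;
    rewrite !happE.
- exact: canonical_symK.
- by move=> A; apply: (hom_ext (total_tpure (tt A) total_tone)) => i;
    rewrite !happE.
(* Both sides send (u @ v) @ w to v @ (w @ u). *)
- by move=> A B D; apply: (hom_ext (total_tpure (@total_tpure_all A B) (tt D))) => i;
    rewrite !happE.
Qed.

End Canonical.

(** * Uniqueness and existence of the canonical constraints *)

Lemma canonical_unique (k k' : constraints T) :
  canonical_constraints k -> canonical_constraints k' -> k' = k.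
Proof.
move=> kc kc'.
have tt := total_all.
have ea A B D : cassoc k' A B D = cassoc k A B D.
  by apply: (hom_ext (total_tpure (@total_tpure_all A B) (tt D))) => i;
    rewrite (happ_assoc kc) (happ_assoc kc').
have el A : clunit k' A = clunit k A.
  by apply: (hom_ext (total_tpure total_tone (tt A))) => i;
    rewrite (happ_lunit kc) (happ_lunit kc').
have er A : crunit k' A = crunit k A.
  by apply: (hom_ext (total_tpure (tt A) total_tone)) => i;
    rewrite (happ_runit kc) (happ_runit kc').
have es A B : csym k' A B = csym k A B.
  by apply: (hom_ext (@total_tpure_all A B)) => i; rewrite (happ_sym kc) (happ_sym kc').
case: k k' {kc kc'} ea el er es => [a l r s] [a' l' r' s'] /= ea el er es.
congr Constraints; do ?[apply: functional_extensionality_dep => ?];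
  [exact: ea|exact: el|exact: er|exact: es].
Qed.

Lemma canonical_exists : exists k : constraints T, canonical_constraints k.
Proof.
pose a A B D := cid (assoc_exists A B D).
pose l A := cid (lunit_exists A).
pose s A B := cid (sym_exists A B).
(* The symmetry sends u @ 1 to 1 @ u, which the left unit constraint sends to u. *)
pose r A : hom (tens T A (tunit T)) A := sval (l A) \oc sval (s A (tunit T)).
exists (@Constraints C T (fun A B D => sval (a A B D)) (fun A => sval (l A)) r
  (fun A B => sval (s A B))).
split=> [A B D|A|A u|A B]; first exact: (svalP (a A B D)).
- exact: (svalP (l A)).
- exact: etrans (congr1 (happ (sval (l A))) (svalP (s A (tunit T)) u tone))
    (svalP (l A) u).
- exact: (svalP (s A B)).
Qed.

End Constraints.

Theorem proposition60 (R : topRingType) (hR : rigid R) :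
  exists k : constraints (topfree_tensor hR),
    canonical_constraints k /\
    (forall k' : constraints (topfree_tensor hR),
       canonical_constraints k' -> k' = k) /\
    symmetric_monoidal k.
Proof.
have [k kc] := canonical_exists hR; exists k; split=> //; split.
- by move=> k'; exact: canonical_unique.
- exact: canonical_monoidal.
Qed.
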